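(* There exists an absolute constant $c>0$ such that for every prime number $p$ and every subset $A\subset\mathbb{F}_p$ with $|A|>p^{2/3}$, $$ \max\{|A+A|,\ |AA|\}\ \ge\ c\,p^{1/2}|A|^{1/2}. $$
   Context: $\mathbb{F}_p$ denotes the field of residue classes modulo the prime $p$, and $|X|$ denotes the cardinality of a finite set $X$. For $A\subset\mathbb{F}_p$, the sum set is $A+A=\{a+b:\ a\in A,\ b\in A\}$ and the product set is $AA=\{ab:\ a\in A,\ b\in A\}$. The constant $c$ does not depend on $p$ or $A$ (the paper writes this inequality with the symbol $\gg$). *)

(* Defs.v *)
From mathcomp Require Import all_boot all_order all_algebra.
Set Implicit Arguments.
Unset Strict Implicit.
Unset Printing Implicit Defensive.
Import GRing.Theory.
Local Open Scope ring_scope.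

Definition sumset (V : finZmodType) (A B : {set V}) : {set V} :=
  [set a + b | a in A, b in B].

Definition prodset (K : finNzRingType) (A B : {set K}) : {set K} :=
  [set a * b | a in A, b in B].

(* Main.v *)
Require Import Defs.
From mathcomp Require Import all_boot all_order all_algebra.
From mathcomp Require Import reals exp.
From mathcomp Require Import ring lra.
Set Implicit Arguments.
Unset Strict Implicit.
Unset Printing Implicit Defensive.
Import Order.TTheory GRing.Theory Num.Theory.
Local Open Scope ring_scope.

(** The product P = (A+A) x (AA) is a set of points of the plane over a field
    of q elements that is met unusually often by the |A| |B| lines y = b (x - a) with a in A and b
    in B = A \ {0}: each of them passes through the |A| points (a + c, b c) with
    c in A, so there are at least |A|^2 |B| incidences ([card_incidences_ge]).

    On the other hand, as two distinct non-vertical lines meet at most once, the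
    number of lines of a family L through a random point of the plane has mean
    |L| / q and variance at most |L| / q ([sum_sqr_degree]).  By the
    Cauchy-Schwarz inequality the number I of incidences between any set P of
    points and L satisfies (q I - |P| |L|)^2 <= q^3 |P| |L|
    ([incidence_bound]).  Hence |A|^2 |B| is O(|P| |L| / q), giving
    |P| >> q |A|, or it is O(sqrt(q |P| |L|)), giving |P| >> |A|^4 / q, which is
    at least q |A| when |A|^3 > q^2.  In both cases the product |A+A| |AA| is
    >> q |A|, and the larger factor is at least its square root. *)

(** Cauchy-Schwarz against the constant function 1, from Lagrange's identity:
    the sum of (g x - g y)^2 over all pairs is twice the difference of the two
    sides. *)
Lemma sqr_sum_le (R : realDomainType) (T : finType) (P : {set T}) (g : T -> R) :
  (\sum_(x in P) g x) ^+ 2 <= #|P|%:R * \sum_(x in P) g x ^+ 2.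
Proof.
set s := \sum_(x in P) g x; set s2 := \sum_(x in P) _.
have sum_sqrB : 0 <= \sum_(x in P) \sum_(y in P) (g x - g y) ^+ 2.
  by apply: sumr_ge0 => x _; apply: sumr_ge0 => y _; exact: sqr_ge0.
suff E : \sum_(x in P) \sum_(y in P) (g x - g y) ^+ 2
         = 2 * (#|P|%:R * s2 - s ^+ 2) by move: sum_sqrB; rewrite E; lra.
have inner x : \sum_(y in P) (g x - g y) ^+ 2
               = #|P|%:R * g x ^+ 2 - 2 * s * g x + s2.
  transitivity (\sum_(y in P) (g x ^+ 2 - 2 * g x * g y + g y ^+ 2)).
    by apply: eq_bigr => y _; ring.
  by rewrite big_split sumrB /= sumr_const -mulr_sumr -/s -/s2 -mulr_natl; ring.
under eq_bigr do rewrite inner.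
rewrite big_split sumrB /= sumr_const -!mulr_sumr -/s -/s2 -mulr_natl; ring.
Qed.

Section Incidences.
Variable F : finFieldType.

(** A pair (m, k) stands for the line y = m x + k. *)
Definition on_line (x l : F * F) : bool := x.2 == l.1 * x.1 + l.2.

Definition degree (L : {set F * F}) (x : F * F) : nat :=
  #|[set l in L | on_line x l]|.

Lemma degreeE (R : pzSemiRingType) (L : {set F * F}) x :
  (degree L x)%:R = \sum_(l in L) (on_line x l)%:R :> R.
Proof.
rewrite -natr_sum /degree -sum1_card; congr _%:R.
rewrite big_mkcond [RHS]big_mkcond; apply: eq_bigr => l _.
by rewrite inE; case: (l \in L); case: on_line.
Qed.

Lemma card_line l : #|[set x | on_line x l]| = #|F|.
Proof.
have inj : injective (fun s : F => (s, l.1 * s + l.2)) by move=> s t [].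
rewrite -(card_imset _ inj); apply: eq_card => -[s t]; rewrite inE /on_line /=.
apply/eqP/imsetP => [-> | [u _ [-> ->]] //]; by exists s.
Qed.

Lemma card_line_meet l l' : l != l' ->
  (#|[set x | on_line x l && on_line x l']| <= 1)%N.
Proof.
case: l l' => m k [m' k'] neq; apply/card_le1_eqP => -[s t] [s' t'].
rewrite !inE /on_line /= => /andP[/eqP-> /eqP E] /andP[/eqP-> /eqP E'].
have : (m - m') * (s - s') == 0.
  by apply/eqP; transitivity ((m * s + k) - (m * s' + k) - m' * (s - s'));
     [ring | rewrite E E'; ring].
rewrite mulf_eq0 !subr_eq0 => /orP[/eqP mE|/eqP-> //].
by move: neq E; rewrite mE xpair_eqE eqxx /= => /eqP neq /addrI.
Qed.

Lemma sum_degree (R : pzSemiRingType) (L : {set F * F}) :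
  \sum_x (degree L x)%:R = #|F|%:R * #|L|%:R :> R.
Proof.
under eq_bigr do rewrite degreeE.
rewrite exchange_big /=.
under eq_bigr => l _.
  rewrite -natr_sum -big_mkcond /= sum1dep_card card_line; over.
by rewrite sumr_const mulr_natr.
Qed.

(** The sum counts triples of a point and two lines through it, so that distinct
    lines contribute at most 1 and equal lines contribute q. *)
Lemma sum_degree_sqr (R : realDomainType) (L : {set F * F}) :
  \sum_x (degree L x)%:R ^+ 2 <= #|L|%:R ^+ 2 + #|F|%:R * #|L|%:R :> R.
Proof.
under eq_bigr do rewrite expr2 degreeE big_distrlr /=.
rewrite exchange_big /=.
under eq_bigr do rewrite exchange_big /=.
have E : \sum_(l in L) \sum_(l' in L) (1 + #|F|%:R * (l == l')%:R)
         = #|L|%:R ^+ 2 + #|F|%:R * #|L|%:R :> R.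
  under eq_bigr => l lL.
    rewrite big_split /= sumr_const -mulr_sumr (bigD1 l) //= eqxx big1; last first.
      by move=> l' /andP[_ /negPf]; rewrite eq_sym => ->.
    rewrite addr0 mulr1; over.
  by rewrite sumr_const -mulr_natr; ring.
rewrite -{}E; apply: ler_sum => l _; apply: ler_sum => l' _.
under eq_bigr do rewrite -natrM mulnb.
rewrite -natr_sum -big_mkcond sum1dep_card /=.
have [<-|/card_line_meet le1] := eqVneq l l'.
  under eq_finset do rewrite andbb.
  by rewrite card_line mulr1 lerDr ler01.
by rewrite mulr0 addr0 lern1.
Qed.

(** The variance of [degree L], whose mean is |L| / q, scaled by q^4 to avoid
    denominators. *)
Lemma sum_sqr_degree (R : realDomainType) (L : {set F * F}) :
  \sum_x (#|F|%:R * (degree L x)%:R - #|L|%:R) ^+ 2 <= #|F|%:R ^+ 3 * #|L|%:R :> R.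
Proof.
set q : R := #|F|%:R; set n : R := #|L|%:R.
have -> : \sum_x (q * (degree L x)%:R - n) ^+ 2
          = q ^+ 2 * \sum_x (degree L x)%:R ^+ 2 - q ^+ 2 * n ^+ 2.
  transitivity (\sum_x (q ^+ 2 * (degree L x)%:R ^+ 2
                        - 2 * q * n * (degree L x)%:R + n ^+ 2)).
    by apply: eq_bigr => x _; ring.
  rewrite big_split sumrB /= sumr_const -!mulr_sumr sum_degree -/q -/n.
  by rewrite card_prod -[_ *+ (_ * _)]mulr_natr natrM -/q; ring.
have := ler_wpM2l (sqr_ge0 q) (sum_degree_sqr R L); rewrite -/q -/n.
lra.
Qed.

(** The left-hand side is the square of the sum over P of q times the deviation
    of [degree L] from its mean; extending the sum of their squares from P to the
    whole plane makes [sum_sqr_degree] available. *)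
Lemma incidence_bound (R : realDomainType) (P L : {set F * F}) :
  (#|F|%:R * (\sum_(x in P) degree L x)%:R - #|P|%:R * #|L|%:R) ^+ 2
    <= #|F|%:R ^+ 3 * #|P|%:R * #|L|%:R :> R.
Proof.
have -> : #|F|%:R * (\sum_(x in P) degree L x)%:R - #|P|%:R * #|L|%:R
          = \sum_(x in P) (#|F|%:R * (degree L x)%:R - #|L|%:R) :> R.
  by rewrite natr_sum sumrB sumr_const -mulr_sumr -[X in _ = _ - X]mulr_natl.
apply: le_trans (sqr_sum_le _ _) _.
rewrite mulrAC mulrC ler_wpM2r ?ler0n //; last first.
apply: le_trans (sum_sqr_degree R L).
rewrite [leRHS](bigID (mem P)) /= lerDl.
by apply: sumr_ge0 => x _; exact: sqr_ge0.
Qed.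

Variable A : {set F}.
Let B := A :\ 0.

(** The lines y = b (x - a), whose intercept is - (b a). *)
Definition sum_product_lines : {set F * F} :=
  [set (u.2, - (u.2 * u.1)) | u in setX A B].

Lemma card_sum_product_lines : #|sum_product_lines| = (#|A| * #|B|)%N.
Proof.
rewrite card_in_imset ?cardsX // => -[a b] [a' b'] /setXP[_].
rewrite !inE /= => /andP[b0 _] _ [<-] /oppr_inj /(mulfI b0) ->; by [].
Qed.

Lemma card_incidences_ge :
  (#|A| * #|sum_product_lines|
     <= \sum_(x in setX (sumset A A) (prodset A A)) degree sum_product_lines x)%N.
Proof.
set P := setX _ _; set L := sum_product_lines.
have -> : (\sum_(x in P) degree L x
           = \sum_(l in L) #|[set x in P | on_line x l]|)%N.
  rewrite /degree; under eq_bigr do rewrite -sum1dep_card big_mkcondr.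
  rewrite exchange_big /=; apply: eq_bigr => l _.
  by rewrite -big_mkcondr sum1dep_card.
rewrite mulnC -sum_nat_const; apply: leq_sum => l /imsetP[[a b] /setXP[/= aA]].
rewrite inE => /andP[b0 bA] ->.
have inj : injective (fun c : F => (a + c, b * c)) by move=> c c' [/addrI].
rewrite -(card_imset _ inj); apply/subset_leq_card/subsetP => _ /imsetP[c cA ->].
rewrite !inE /on_line /=; apply/andP; split; last by apply/eqP; ring.
by apply/andP; split; apply: imset2_f.
Qed.

(** With n = |A|, m = |B|, X = |A+A| |AA| and I incidences, I >= n^2 m and there
    are n m lines.  If X < q n / 8, the expected number X n m / q of incidences is
    small enough that q I - X n m >= (7/8) q n^2 m.  Then [incidence_bound] gives
    (49/64) n^2 m < q^2 / 8, whereas m >= n / 2 and n^3 >= q^2. *)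
Lemma sumset_prodset_ge (R : realFieldType) :
  (1 < #|A|)%N -> #|F|%:R ^+ 2 <= #|A|%:R ^+ 3 :> R ->
  #|F|%:R * #|A|%:R / 8 <= #|sumset A A|%:R * #|prodset A A|%:R :> R.
Proof.
move=> A_gt1 A_large.
have /(_ R) := incidence_bound _ (setX (sumset A A) (prodset A A)) sum_product_lines.
have := card_incidences_ge; rewrite card_sum_product_lines cardsX.
set I := (\sum_(x in _) _)%N; rewrite -(ler_nat R) !natrM.
(* Removing 0 from A costs at most half of it, as |A| >= 2. *)
have Bge : #|A|%:R / 2 <= #|B|%:R :> R.
  rewrite ler_pdivrMr ?ltr0n // -natrM ler_nat.
  move: A_gt1; rewrite (cardsD1 0 A) -/B muln2 -addnn leq_add2r.
  by case: (0 \in A).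
have q0 : 0 < #|F|%:R :> R by rewrite ltr0n; apply/card_gt0P; exists 0.
have n0 : 0 < #|A|%:R :> R by rewrite ltr0n ltnW.
move: I%:R (#|sumset A A|%:R * _) => i X.
move: #|F|%:R #|A|%:R #|B|%:R q0 n0 A_large Bge
  => q n m q0 n0 n3_ge m_ge I_ge I_le.
rewrite leNgt; apply/negP => X_lt.
have m0 : 0 < m by lra.
have nm0 : 0 < n * m by rewrite mulr_gt0.
have dev_ge : 7 / 8 * (q * n) * (n * m) <= q * i - X * (n * m).
  have := ler_wpM2l (ltW q0) I_ge; have := ler_wpM2r (ltW nm0) (ltW X_lt).
  lra.
have dev_ge0 : 0 <= 7 / 8 * (q * n) * (n * m) by rewrite !mulr_ge0 ?ltW //; lra.
have : (7 / 8 * (q * n) * (n * m)) ^+ 2 < q ^+ 3 * (q * n / 8) * (n * m).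
  apply: le_lt_trans (_ : _ <= (q * i - X * (n * m)) ^+ 2) _.
    by rewrite ler_sqr // nnegrE // (le_trans dev_ge0).
  by apply: le_lt_trans I_le _; rewrite ltr_pM2r // ltr_pM2l // exprn_gt0.
have -> : q ^+ 3 * (q * n / 8) * (n * m) = q ^+ 2 * n ^+ 2 * m * (q ^+ 2 / 8) by ring.
have -> : (7 / 8 * (q * n) * (n * m)) ^+ 2
          = q ^+ 2 * n ^+ 2 * m * (49 / 64 * n ^+ 2 * m) by field.
rewrite ltr_pM2l ?mulr_gt0 ?exprn_gt0 //.
have : n ^+ 3 / 2 <= n ^+ 2 * m.
  by rewrite exprSr -mulrA ler_pM2l ?exprn_gt0.
have : 0 < q ^+ 2 by rewrite exprn_gt0.
lra.
Qed.

End Incidences.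

Theorem mainTheorem2 (R : realType) :
  exists c : R, 0 < c /\
    forall p : nat, prime p ->
    forall A : {set 'F_p},
      p%:R `^ (2 / 3) < #|A|%:R :> R ->
      c * p%:R `^ (1 / 2) * #|A|%:R `^ (1 / 2)
        <= Num.max #|sumset A A|%:R #|prodset A A|%:R.
Proof.
(* 1/4 is a rational number whose square is at most the 1/8 of
   [sumset_prodset_ge]. *)
exists (1 / 4); split=> [|p p_pr A A_gt]; first lra.
have p_ge1 : 1 <= p%:R :> R by rewrite ler1n prime_gt0.
have A_gt1 : (1 < #|A|)%N.
  rewrite -(ltr_nat R); apply: le_lt_trans A_gt.
  by rewrite -[leLHS](powRr0 p%:R) ler_powR //; lra.
have A_large : p%:R ^+ 2 <= #|A|%:R ^+ 3 :> R.
  have -> : p%:R ^+ 2 = (p%:R `^ (2 / 3)) ^+ 3 :> R.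
    rewrite -!powR_mulrn ?powR_ge0 ?ler0n // -powRrM; congr (_ `^ _); by field.
  by rewrite lerXn2r ?nnegrE ?powR_ge0 ?ler0n // ltW.
have := @sumset_prodset_ge _ A R A_gt1.
rewrite card_Fp // => /(_ A_large).
move: #|sumset A A|%:R (ler0n R #|sumset A A|) #|prodset A A|%:R => S S_ge0 T ST_ge.
rewrite !div1r !powR12_sqrt ?ler0n //.
set M := Num.max S T.
have S_le : S <= M by rewrite le_max lexx.
have T_le : T <= M by rewrite le_max lexx orbT.
have M_ge0 : 0 <= M := le_trans S_ge0 S_le.
rewrite -ler_sqr ?nnegrE ?mulr_ge0 ?sqrtr_ge0 ?invr_ge0 ?ler0n //.
rewrite !exprMn !sqr_sqrtr ?ler0n //.
have : S * T <= M ^+ 2.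
  by rewrite expr2; apply: le_trans (ler_wpM2l S_ge0 T_le) _; rewrite ler_wpM2r.
have : 0 <= p%:R * #|A|%:R :> R by rewrite mulr_ge0 ?ler0n.
lra.
Qed.
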